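(* Let $\mathbf A$ be a finite idempotent algebra. If every pair $(s_0,s_1)\in(A^2\times\{0,1\})^2$ has a local difference term operation (i.e. $\{s_0,s_1\}$ has one), then every subset $S\subseteq A^2\times\{0,1\}$ has a local difference term operation.
   Context: An algebra is idempotent if each basic operation satisfies $f(x,\dots,x)=x$. For $a,b\in A$ let $\theta_{ab}=\mathrm{Cg}^{\mathbf A}(a,b)$ and let $[\cdot,\cdot]$ be the term-condition commutator. A ternary term operation $t$ of $\mathbf A$ is a local difference term operation for $(a,b,i)\in A^2\times\{0,1\}$ if: when $i=0$, $(a,t(a,b,b))\in[\theta_{ab},\theta_{ab}]$; when $i=1$, $t(a,a,b)=b$. It is a local difference term operation for $S\subseteq A^2\times\{0,1\}$ if it is one for every triple in $S$. *)

(* Defs.v *)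
From Corelib Require RelationClasses.
From mathcomp Require Import all_boot.

Set Implicit Arguments.
Unset Strict Implicit.
Unset Printing Implicit Defensive.

(* The set of operation symbols is arbitrary, possibly infinite, and arity 0
   is allowed. *)
Record signature : Type := Signature {
  symbol :> Type;
  arity : symbol -> nat
}.

(* Terms in the variables x_0, ..., x_(n-1). *)
Inductive term (sg : signature) (n : nat) : Type :=
  | Var of 'I_n
  | App (f : sg) of ('I_(arity f) -> term sg n).

Record algebra (sg : signature) : Type := Algebra {
  carrier :> finType;
  op : forall f : sg, (arity f).-tuple carrier -> carrier
}.

Section Algebras.

Variables (sg : signature) (A : algebra sg).

Definition idempotent_algebra : Prop :=
  forall (f : sg) (x : A), op (nseq_tuple (arity f) x) = x.

Fixpoint eval (n : nat) (t : term sg n) (e : n.-tuple A) : A :=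
  match t with
  | Var i => tnth e i
  | App f ts => op [tuple eval (ts i) e | i < arity f]
  end.

Definition ternary_term_operation (t : A -> A -> A -> A) : Prop :=
  exists u : term sg 3, forall x y z, t x y z = eval u [tuple x; y; z].

Implicit Types alpha beta delta theta : A -> A -> Prop.

Definition congruence theta : Prop :=
  RelationClasses.Equivalence theta /\
  forall (f : sg) (u v : (arity f).-tuple A),
    (forall i, theta (tnth u i) (tnth v i)) -> theta (op u) (op v).

(* Both Cg and commutator are least elements, given as intersections; see
   Cg_least and commutator_least. *)
Definition Cg (a b : A) : A -> A -> Prop :=
  fun x y => forall theta, congruence theta -> theta a b -> theta x y.

(* The term condition C(alpha, beta; delta). *)
Definition centralizes alpha beta delta : Prop :=
  forall (m n : nat) (t : term sg (m + n))
         (a b : m.-tuple A) (c d : n.-tuple A),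
    (forall i, alpha (tnth a i) (tnth b i)) ->
    (forall j, beta (tnth c j) (tnth d j)) ->
    delta (eval t [tuple of a ++ c]) (eval t [tuple of a ++ d]) ->
    delta (eval t [tuple of b ++ c]) (eval t [tuple of b ++ d]).

Definition commutator alpha beta : A -> A -> Prop :=
  fun x y => forall delta,
    congruence delta -> centralizes alpha beta delta -> delta x y.

Definition local_difference_term_operation
    (t : A -> A -> A -> A) (s : A * A * 'I_2) : Prop :=
  let: (a, b, i) := s in
  if i == ord0 then commutator (Cg a b) (Cg a b) a (t a b b)
  else t a a b = b.

Definition has_local_difference_term_operation
    (S : {set A * A * 'I_2}) : Prop :=
  exists2 t, ternary_term_operation t &
             forall s, s \in S -> local_difference_term_operation t s.

Lemma congruence_bigcap (P : (A -> A -> Prop) -> Prop) :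
  congruence (fun x y => forall theta, congruence theta -> P theta -> theta x y).
Proof.
split; first split.
- by move=> x theta [[r _ _] _] _; apply: r.
- by move=> x y xy theta th Pth; have [[_ s _] _] := th; apply: s; apply: xy.
- move=> x y z xy yz theta th Pth; have [[_ _ tr] _] := th.
  by apply: (tr _ y); [apply: xy | apply: yz].
- by move=> f u v uv theta th Pth; apply: th.2 => i; apply: uv.
Qed.

Lemma Cg_least (a b : A) :
  [/\ congruence (Cg a b), Cg a b a b &
      forall theta, congruence theta -> theta a b ->
        forall x y, Cg a b x y -> theta x y].
Proof.
split; first exact: (congruence_bigcap (fun theta => theta a b)).
- by move=> theta _.
- by move=> theta th thab x y; apply.
Qed.

Lemma commutator_least alpha beta :
  [/\ congruence (commutator alpha beta),
      centralizes alpha beta (commutator alpha beta) &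
      forall delta, congruence delta -> centralizes alpha beta delta ->
        forall x y, commutator alpha beta x y -> delta x y].
Proof.
split; first exact: (congruence_bigcap (centralizes alpha beta)).
- move=> m n t a b c d ab cd H delta dc dC.
  by apply: (dC _ _ _ _ _ _ _ ab cd); apply: H.
- by move=> delta dc dC x y; apply.
Qed.

End Algebras.

(* Main.v *)
Require Import Defs.
From mathcomp Require Import all_boot.

(** Induction on the size of S.  A set with at least three triples contains two
    with the same last coordinate, say s and s'.  Let p be a local difference
    term operation for S minus s, and let t be one for the set obtained from S
    by discarding all triples with that last coordinate and adding
    (a, p(a,b,b), 0) if s = (a, b, 0), or (p(a,a,b), b, 1) if s = (a, b, 1);
    this set is smaller than S.  Then t(x, p(x,y,y), p(x,y,z)), respectively
    t(p(x,y,z), p(y,y,z), z), works for all of S. *)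

Set Implicit Arguments.
Unset Strict Implicit.
Unset Printing Implicit Defensive.

Section LocalDifferenceTerms.

Variables (sg : signature) (A : algebra sg).

Implicit Types (t p : A -> A -> A -> A) (alpha beta theta : A -> A -> Prop).

Fixpoint subst (m n : nat) (u : term sg m) (v : 'I_m -> term sg n) : term sg n :=
  match u with
  | Var i => v i
  | App f us => App (fun i => subst (us i) v)
  end.

Lemma eval_subst (m n : nat) (u : term sg m) (v : 'I_m -> term sg n)
    (e : n.-tuple A) :
  eval (subst u v) e = eval u [tuple eval (v i) e | i < m].
Proof.
elim: u => [i|f us IH] /=; first by rewrite tnth_mktuple.
by congr op; apply: eq_mktuple => i; apply: IH.
Qed.

Lemma ternary_term_proj1 : ternary_term_operation (fun x _ _ : A => x).
Proof. by exists (Var sg ord0). Qed.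

Lemma ternary_term_proj2 : ternary_term_operation (fun _ y _ : A => y).
Proof. by exists (Var sg (Ordinal (isT : 1 < 3))). Qed.

Lemma ternary_term_proj3 : ternary_term_operation (fun _ _ z : A => z).
Proof. by exists (Var sg (Ordinal (isT : 2 < 3))). Qed.

(** Guarantees that the operations built in the induction step are term operations; the witness
    substitutes the three inner terms for the variables of the outer one. *)
Lemma ternary_term_comp t p q r :
  ternary_term_operation t -> ternary_term_operation p ->
  ternary_term_operation q -> ternary_term_operation r ->
  ternary_term_operation (fun x y z => t (p x y z) (q x y z) (r x y z)).
Proof.
move=> [u tE] [v pE] [w qE] [s rE].
exists (subst u (tnth [tuple v; w; s])) => x y z.
rewrite eval_subst tE pE qE rE; congr eval.
apply: eq_from_tnth => i; rewrite tnth_mktuple.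
by case: i => [[|[|[|//]]]] lti.
Qed.

Lemma eval_congruence theta (n : nat) (u : term sg n) (c d : n.-tuple A) :
  congruence theta -> (forall i, theta (tnth c i) (tnth d i)) ->
  theta (eval u c) (eval u d).
Proof.
move=> th cd; elim: u => [i|f us IH] /=; first exact: cd.
by apply: th.2 => i; rewrite !tnth_mktuple; apply: IH.
Qed.

Lemma ternary_term_congruence t theta x y z x' y' z' :
  ternary_term_operation t -> congruence theta ->
  theta x x' -> theta y y' -> theta z z' -> theta (t x y z) (t x' y' z').
Proof.
move=> [u tE] th xx' yy' zz'; rewrite !tE; apply: eval_congruence => //.
by case=> [[|[|[|//]]]] lti.
Qed.

Lemma eval_idempotent (n : nat) (u : term sg n) (x : A) :
  idempotent_algebra A -> eval u (nseq_tuple n x) = x.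
Proof.
move=> idemA; elim: u => [i|f us IH] /=; first by rewrite tnth_nseq.
rewrite -[RHS](idemA f); congr op.
by apply: eq_from_tnth => i; rewrite tnth_mktuple tnth_nseq.
Qed.

Lemma ternary_term_idempotent t x :
  idempotent_algebra A -> ternary_term_operation t -> t x x x = x.
Proof.
move=> idemA [u tE]; rewrite tE -[RHS](eval_idempotent u x idemA).
by congr eval; apply: val_inj.
Qed.

Lemma commutator_mono alpha beta alpha' beta' :
  (forall x y, alpha x y -> alpha' x y) -> (forall x y, beta x y -> beta' x y) ->
  forall x y, commutator alpha beta x y -> commutator alpha' beta' x y.
Proof.
move=> sa sb x y xy delta cd C; apply: xy => // m n u a b c d ab cc.
by apply: C => i; [apply: sa | apply: sb].
Qed.

Lemma Cg_mono (a b c d : A) :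
  Cg a b c d -> forall x y, Cg c d x y -> Cg a b x y.
Proof. by move=> cd x y xy theta th ab; apply: xy => //; apply: cd. Qed.

Lemma has_ldt_subset (S T : {set A * A * 'I_2}) :
  S \subset T -> has_local_difference_term_operation T ->
  has_local_difference_term_operation S.
Proof. by move=> /subsetP ST [t tt tT]; exists t => // s /ST /tT. Qed.

Hypothesis idemA : idempotent_algebra A.

(** At [(c, d, 1)], [p c c c = c] and [p c c d = d] leave [t c c d], which is [d]. At [(c, d, 0)]
    other than [(a, b, 0)], [p c d d] is commutator-related to [c], so the value is related to
    [t c c c = c]. At [(a, b, 0)] the choice of [t] applies directly, but with the commutator of a
    smaller congruence. *)
Lemma ldt_step0 p t (a b : A) (S : {set A * A * 'I_2}) :
  ternary_term_operation p -> ternary_term_operation t ->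
  {in S :\ (a, b, ord0), forall s, local_difference_term_operation p s} ->
  {in (a, p a b b, ord0) |: [set s in S | s.2 != ord0],
    forall s, local_difference_term_operation t s} ->
  {in S, forall s, local_difference_term_operation
                     (fun x y z => t x (p x y y) (p x y z)) s}.
Proof.
move=> pT tT pS tS [[c d] i] sS; rewrite /local_difference_term_operation.
have [i0|i0] := eqVneq i ord0; last first.
  have := pS (c, d, i); have := tS (c, d, i).
  rewrite !inE sS /= i0 orbT => /(_ isT) tE.
  rewrite xpair_eqE (negPf i0) andbF => /(_ isT) pE.
  rewrite (ternary_term_idempotent c idemA pT).
  by rewrite /= (negPf i0) in tE pE; rewrite pE.
rewrite {}i0 in sS *; have [[-> ->]|ne] := (c, d, ord0) =P (a, b, ord0 : 'I_2).
  have := tS (a, p a b b, ord0); rewrite !inE eqxx => /(_ isT) /=.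
  have [cg ab _] := Cg_least a b; have [[refl _ _] _] := cg.
  (* Since [p a b b] is congruent to [p a a a = a], the congruence generated by [(a, p a b b)] lies
     below [Cg a b]. *)
  have /Cg_mono sub : Cg a b a (p a b b).
    rewrite -{2}(ternary_term_idempotent a idemA pT).
    exact: (ternary_term_congruence pT cg (refl a) ab ab).
  exact: commutator_mono.
have := pS (c, d, ord0); rewrite !inE sS; move/eqP: ne => -> /(_ isT) /= pE.
have [com _ _] := commutator_least (Cg c d) (Cg c d); have [[refl _ _] _] := com.
rewrite -{3}(ternary_term_idempotent c idemA tT).
exact: (ternary_term_congruence tT com (refl c) pE pE).
Qed.

(** At [(c, d, 0)], [p d d d = d] leaves [t (p c d d) d d], which is commutator-related to [t c d d]
    and hence to [c]. At [(a, b, j)] the value is [t (p a a b) (p a a b) b = b]; at any other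
    [(c, d, j)], [p c c d = d] leaves [t d d d]. *)
Lemma ldt_step1 p t (a b : A) (j : 'I_2) (S : {set A * A * 'I_2}) :
  j != ord0 ->
  ternary_term_operation p -> ternary_term_operation t ->
  {in S :\ (a, b, j), forall s, local_difference_term_operation p s} ->
  {in (p a a b, b, j) |: [set s in S | s.2 != j],
    forall s, local_difference_term_operation t s} ->
  {in S, forall s, local_difference_term_operation
                     (fun x y z => t (p x y z) (p y y z) z) s}.
Proof.
move=> j0 pT tT pS tS [[c d] i] sS; rewrite /local_difference_term_operation.
have [i0|i0] := eqVneq i ord0.
  rewrite {}i0 in sS *; have := pS (c, d, ord0); have := tS (c, d, ord0).
  rewrite !inE sS xpair_eqE [_ == j]eq_sym (negPf j0) orbT => /(_ isT) /= tE.
  rewrite xpair_eqE [_ == j]eq_sym (negPf j0) andbF => /(_ isT) /= pE.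
  rewrite (ternary_term_idempotent d idemA pT).
  have [com _ _] := commutator_least (Cg c d) (Cg c d).
  have [[refl _ trans] _] := com.
  apply: (trans _ _ _ tE).
  exact: (ternary_term_congruence tT com pE (refl d) (refl d)).
(* ['I_2] has only one nonzero element. *)
have ij : i = j.
  by case: i j i0 j0 {pS tS sS} => [[|[|//]] ?] [[|[|//]] ?] // _ _; apply: val_inj.
rewrite {}ij in sS i0 *; have [[-> ->]|ne] := (c, d, j) =P (a, b, j).
  have := tS (p a a b, b, j); rewrite !inE eqxx => /(_ isT) /=.
  by rewrite (negPf j0).
have := pS (c, d, j); rewrite !inE sS; move/eqP: ne => -> /(_ isT) /=.
by rewrite (negPf j0) => ->; apply: ternary_term_idempotent.
Qed.

(** Pigeonhole on the two possible last coordinates: fibres of size at most 1 would force [S] to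
    have at most 2 elements. *)
Lemma card_gt2_fiber (S : {set A * A * 'I_2}) :
  2 < #|S| -> exists2 s, s \in S & 1 < #|[set s' in S | s'.2 == s.2]|.
Proof.
move=> S3.
have [i Si] : exists i : 'I_2, 1 < #|[set s in S | s.2 == i]|.
  apply/existsP; apply: contraLR S3; rewrite negb_exists -leqNgt => /forallP le1.
  have -> : #|S| = \sum_(i < 2) #|[set s in S | s.2 == i]|.
    rewrite -sum1_card (partition_big (fun s => s.2) xpredT) //=.
    apply: eq_bigr => i _; rewrite -sum1_card.
    by apply: eq_bigl => s; rewrite inE.
  rewrite !big_ord_recl big_ord0 addn0.
  by rewrite (leq_add (n1 := 1) (n2 := 1)) // leqNgt.
have /card_gt0P [s] : 0 < #|[set s in S | s.2 == i]| by apply: ltnW.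
by rewrite inE => /andP [sS /eqP si]; exists s; rewrite ?si.
Qed.

(** At least two triples are traded for one; this makes the induction hypothesis available for the
    set that determines [t]. *)
Lemma card_replace_fiber (S : {set A * A * 'I_2}) (i : 'I_2) s :
  1 < #|[set s' in S | s'.2 == i]| ->
  #|s |: [set s' in S | s'.2 != i]| < #|S|.
Proof.
move=> Si; rewrite -(cardsID [set s' | s'.2 == i] S).
have -> : S :&: [set s' | s'.2 == i] = [set s' in S | s'.2 == i].
  by apply/setP => x; rewrite !inE.
have -> : S :\: [set s' | s'.2 == i] = [set s' in S | s'.2 != i].
  by apply/setP => x; rewrite !inE andbC.
(* [cardsU1] counts [s] by a boolean, 0 if [s] was already present; in both cases this is less than
   the size of the fibre. *)
by rewrite cardsU1 ltn_add2r (leq_ltn_trans _ Si) ?leq_b1.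
Qed.

End LocalDifferenceTerms.

Theorem theorem5p1 (sg : signature) (A : algebra sg)
    (idemA : idempotent_algebra A)
    (pairs : forall s0 s1 : A * A * 'I_2,
        has_local_difference_term_operation [set s0; s1]) :
  forall S : {set A * A * 'I_2}, has_local_difference_term_operation S.
Proof.
move=> S; have [n] := ubnP #|S|; elim: n S => // n IH S /ltnSE leSn.
have [S3|S2] := ltnP 2 #|S|; last first.
  (* Base case, at most two triples: a projection serves the empty set, and a singleton is treated
     as the pair [s0], [s0]. *)
  have [->|[s0 s0S]] := set_0Vmem S.
    by exists (fun x _ _ => x) => [|s]; [apply: ternary_term_proj1 | rewrite inE].
  have [S'0|[s1 s1S']] := set_0Vmem (S :\ s0).
    apply: has_ldt_subset (pairs s0 s0).
    by rewrite setUid -setD_eq0 S'0.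
  apply: has_ldt_subset (pairs s0 s1).
  have S''0 : S :\ s0 :\ s1 = set0.
    apply/eqP; rewrite -cards_eq0 -leqn0.
    by move: S2; rewrite (cardsD1 s0 S) s0S (cardsD1 s1 (S :\ s0)) s1S'.
  by rewrite -(setD1K s0S) -(setD1K s1S') S''0 setU0.
have [[[a b] j] sS fib] := card_gt2_fiber S3.
have [p pT pS] : has_local_difference_term_operation (S :\ (a, b, j)).
  by apply: IH; apply: leq_trans leSn; rewrite [X in _ < X](cardsD1 (a, b, j)) sS.
(* The inserted triple is left arbitrary because it depends on [p] and on the value of [j]. *)
have IHfib s : has_local_difference_term_operation (s |: [set s in S | s.2 != j]).
  by apply: IH; apply: leq_trans leSn; apply: card_replace_fiber.
have [P1 P2 P3] := And3 (ternary_term_proj1 A) (ternary_term_proj2 A)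
                        (ternary_term_proj3 A).
have [j0|j0] := eqVneq j ord0.
  rewrite {}j0 in pS IHfib.
  have [t tT tS] := IHfib (a, p a b b, ord0).
  exists (fun x y z => t x (p x y y) (p x y z)); last exact: ldt_step0 tS.
  exact: ternary_term_comp tT P1 (ternary_term_comp pT P1 P2 P2) pT.
have [t tT tS] := IHfib (p a a b, b, j).
exists (fun x y z => t (p x y z) (p y y z) z); last exact: ldt_step1 tS.
exact: ternary_term_comp tT pT (ternary_term_comp pT P2 P2 P3) P3.
Qed.
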